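(* Let $\mathfrak{G} = (G; +, <, \dots)$ be an expansion of a divisible ordered abelian group whose theory is dp-minimal. Then for each $n\ge 1$: (1) if $X\subseteq G^n$ is a definable set with non-empty interior and $X = X_1\cup\dots\cup X_r$ is a partition of $X$ into definable sets, then some $X_i$ has non-empty interior; (2) if $f: G^n\to\overline{G}_+$ is a definable function, then for every open box $B\subseteq G^n$ there exist an open box $B'\subseteq B$ and $\epsilon>0$ such that $f(x)>\epsilon$ for all $x\in B'$.
   Context: Topology on $G^n$ is the product of the order topology; an open box is a product of $n$ open intervals. $\overline{G}$ denotes the completion of $G$ with respect to the order and $\overline{G}_+$ its positive elements; a function $f:G^n\to\overline{G}$ is definable if $\{(a,c)\in G^{n}\times G: c<f(a)\}$ is definable in $\mathfrak{G}$. A complete theory with monster model $\mathcal{U}$ is dp-minimal if there do not exist formulas $\varphi(x;y)$, $\psi(x;z)$ with $x$ a single variable, $a_i\in\mathcal{U}_y$, $b_j\in\mathcal{U}_z$ ($i,j<\omega$) such that for all $i_0,j_0<\omega$ the set $\{\varphi(x;a_{i_0}),\psi(x;b_{j_0})\}\cup\{\neg\varphi(x;a_i): i\ne i_0\}\cup\{\neg\psi(x;b_j): j\ne j_0\}$ is consistent. *)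

(* Defs.v *)
From mathcomp Require Import all_boot.
Set Implicit Arguments. Unset Strict Implicit. Unset Printing Implicit Defensive.

Record language := Language {
  fun_sym : Type; farity : fun_sym -> nat;
  rel_sym : Type;  rarity : rel_sym -> nat }.

Inductive term (L : language) : Type :=
| tvar : nat -> term L
| tapp : forall f : fun_sym L, ('I_(farity f) -> term L) -> term L.

Inductive formula (L : language) : Type :=
| fequal : term L -> term L -> formula L
| frel : forall r : rel_sym L, ('I_(rarity r) -> term L) -> formula L
| fneg : formula L -> formula L
| fand : formula L -> formula L -> formula L
| fex : nat -> formula L -> formula L.

Record structure (L : language) (M : Type) := Structure {
  funs : forall f : fun_sym L, ('I_(farity f) -> M) -> M;
  rels : forall r : rel_sym L, ('I_(rarity r) -> M) -> Prop }.
Arguments funs {L M} s f _.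
Arguments rels {L M} s r _.
Arguments tapp {L} f _.
Arguments frel {L} r _.

Definition upd {M : Type} (v : nat -> M) (x : nat) (e : M) : nat -> M :=
  fun i => if i == x then e else v i.

Fixpoint eval {L : language} {M : Type} (S : structure L M) (v : nat -> M)
  (t : term L) : M :=
  match t with
  | tvar i => v i
  | tapp f args => funs S f (fun i => eval S v (args i))
  end.

Fixpoint sat {L : language} {M : Type} (S : structure L M) (v : nat -> M)
  (phi : formula L) : Prop :=
  match phi with
  | fequal s t => eval S v s = eval S v t
  | frel r ts => rels S r (fun i => eval S v (ts i))
  | fneg p => ~ sat S v p
  | fand p q => sat S v p /\ sat S v q
  | fex x p => exists e : M, sat S (upd v x e) p
  end.

(** Elementary equivalence: same sentences hold (tested on universal closures). *)
Definition elem_equiv {L : language} {M N : Type}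
  (SM : structure L M) (SN : structure L N) : Prop :=
  forall phi : formula L, (forall v, sat SM v phi) <-> (forall w, sat SN w phi).

(** * dp-minimality of Th(M).
   A pattern: formulas phi(x;y), psi(x;z) (x = variable 0, parameters supplied
   by the rest of an assignment), parameter sequences a_i, b_j in a model N
   of Th(M), such that each partial type of the definition is consistent,
   i.e. (compactness) finitely satisfiable in N. *)
Definition dp_pattern {L : language} {N : Type} (SN : structure L N)
  (phi psi : formula L) (a b : nat -> nat -> N) : Prop :=
  forall i0 j0 k : nat, exists e : N,
    sat SN (upd (a i0) 0 e) phi /\ sat SN (upd (b j0) 0 e) psi /\
    (forall i, i < k -> i <> i0 -> ~ sat SN (upd (a i) 0 e) phi) /\
    (forall j, j < k -> j <> j0 -> ~ sat SN (upd (b j) 0 e) psi).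

Definition dp_minimal {L : language} {M : Type} (SM : structure L M) : Prop :=
  forall (N : Type) (SN : structure L N), elem_equiv SM SN ->
  ~ exists (phi psi : formula L) (a b : nat -> nat -> N), dp_pattern SN phi psi a b.

(** * Definable sets (with parameters) in M^n, M^n = 'I_n -> M.
   Variables 0..n-1 are the coordinates, all other variables are parameters. *)
Definition env {M : Type} (n : nat) (x : 'I_n -> M) (v : nat -> M) : nat -> M :=
  fun i => if (insub i : option 'I_n) is Some j then x j else v i.

Definition definable {L : language} {M : Type} (S : structure L M) (n : nat)
  (X : ('I_n -> M) -> Prop) : Prop :=
  exists (phi : formula L) (v : nat -> M), forall x, X x <-> sat S (env x v) phi.

Definition bin {M : Type} (k : nat) (f : ('I_k -> M) -> M) (x y : M) : M :=
  f (fun i => if val i == 0 then x else y).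
Definition binR {M : Type} (k : nat) (R : ('I_k -> M) -> Prop) (x y : M) : Prop :=
  R (fun i => if val i == 0 then x else y).

Fixpoint nmul {M : Type} (add : M -> M -> M) (z : M) (m : nat) (x : M) : M :=
  match m with 0 => z | m'.+1 => add x (nmul add z m' x) end.

Record is_DOAG {M : Type} (add : M -> M -> M) (lt : M -> M -> Prop) (z : M) : Prop := {
  doag_assoc : forall x y w, add x (add y w) = add (add x y) w;
  doag_comm : forall x y, add x y = add y x;
  doag_zero : forall x, add z x = x;
  doag_inv : forall x, exists y, add x y = z;
  doag_irrefl : forall x, ~ lt x x;
  doag_trans : forall x y w, lt x y -> lt y w -> lt x w;
  doag_total : forall x y, lt x y \/ x = y \/ lt y x;
  doag_compat : forall x y w, lt x y -> lt (add x w) (add y w);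
  doag_div : forall (m : nat) x, 0 < m -> exists y, nmul add z m y = x }.

(** * The completion Gbar: an element gamma is represented by its lower cut
   {c in G | c < gamma}; proper cuts without maximum (no +/- infinity). *)
Record cut {M : Type} (lt : M -> M -> Prop) := Cut {
  cutL : M -> Prop;
  cut_ne : exists c, cutL c;
  cut_proper : exists c, ~ cutL c;
  cut_down : forall c d, lt d c -> cutL c -> cutL d;
  cut_nomax : forall c, cutL c -> exists d, lt c d /\ cutL d }.

Definition definable_fun {L : language} {M : Type} (S : structure L M)
  (lt : M -> M -> Prop) (n : nat) (f : ('I_n -> M) -> cut lt) : Prop :=
  definable S (fun y : 'I_n.+1 -> M =>
    cutL (f (fun i : 'I_n => y (widen_ord (leqnSn n) i))) (y ord_max)).

Definition box {M : Type} (lt : M -> M -> Prop) (n : nat) (lo hi : 'I_n -> M)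
  (x : 'I_n -> M) : Prop := forall i, lt (lo i) (x i) /\ lt (x i) (hi i).
Definition open_box_ok {M : Type} (lt : M -> M -> Prop) (n : nat) (lo hi : 'I_n -> M)
  : Prop := forall i, lt (lo i) (hi i).

Definition nonempty_interior {M : Type} (lt : M -> M -> Prop) (n : nat)
  (X : ('I_n -> M) -> Prop) : Prop :=
  exists lo hi, open_box_ok lt lo hi /\ forall x, box lt lo hi x -> X x.

(* Main.v *)
Require Import Defs.
From mathcomp Require Import all_boot.
From mathcomp Require Import boolp classical_sets filter.
Set Implicit Arguments. Unset Strict Implicit. Unset Printing Implicit Defensive.

(** By compactness (an ultrapower), dp-minimality bounds the size of the finite
patterns formed by a sequence of disjoint intervals and any definable family.
In particular, in a definable family, it is impossible that every finite subset
of an interval lies in a single member while finite unions of members are all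
codense there; this gives (2) on the line.

On the line, a definable set [A] has finitely many right germs
[{h > 0 | a + h in A}]: many distinct germs would give a pattern for the family
[(A - a) symdiff (A - b)]. By (2), on some interval germs of the same class agree
up to a uniform distance; a division by [k!] and the pigeonhole principle then
make [A] invariant under all small translations, so [A] is constant on a
subinterval.

In dimension [n + 1], the same covering principle shows that if the fibres of a
definable family are dense in an interval, then a single point [c] lies in all
the fibres over some box. Applied to "the fibre over [x] is constant on some
[(c, e)]", resp. "[f (x, _)] is bounded below on some [(c, e)]", it reduces (1)
and (2) to dimension [n]. *)

(** * Capture-avoiding renaming of variables *)

Section Renaming.
Variables (L : language) (M : Type) (S : structure L M).

Fixpoint trename (s : nat -> nat) (t : term L) : term L :=
  match t with
  | tvar i => tvar L (s i)
  | tapp f args => tapp f (fun i => trename s (args i))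
  end.

(* Free variables are expected to be sent by [s] to even numbers, so that the
   odd number [d.*2.+1] is fresh for the [d]-th nested quantifier. *)
Fixpoint frename_rec (d : nat) (s : nat -> nat) (p : formula L) : formula L :=
  match p with
  | fequal t u => fequal (trename s t) (trename s u)
  | Defs.frel r ts => Defs.frel r (fun i => trename s (ts i))
  | fneg q => fneg (frename_rec d s q)
  | fand q r => fand (frename_rec d s q) (frename_rec d s r)
  | fex x q => fex d.*2.+1 (frename_rec d.+1 (upd s x d.*2.+1) q)
  end.

Definition frename (s : nat -> nat) : formula L -> formula L :=
  frename_rec 0 (double \o s).

Lemma eval_trename v s t : eval S v (trename s t) = eval S (v \o s) t.
Proof.
elim: t => //= f args IH; congr funs; apply: funext => i; exact: IH.
Qed.

Lemma sat_frename_rec p d s v :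
  (forall i, odd (s i) -> s i < d.*2) ->
  sat S v (frename_rec d s p) <-> sat S (v \o s) p.
Proof.
elim: p d s v => [t u|r ts|q IH|q IHq r IHr|x q IH] d s v ds /=.
- by rewrite !eval_trename.
- suff -> : (fun i => eval S v (trename s (ts i))) =
            (fun i => eval S (v \o s) (ts i)) by [].
  by apply: funext => i; exact: eval_trename.
- by rewrite IH.
- by rewrite IHq // IHr.
- have e_ a : upd v d.*2.+1 a \o upd s x d.*2.+1 = upd (v \o s) x a.
    apply: funext => i; rewrite /upd /=; case: (i == x); first by rewrite eqxx.
    case: eqP => // si; have := ds i; rewrite si /= odd_double => /(_ isT).
    by rewrite ltnNge leqnSn.
  have ds' i : odd (upd s x d.*2.+1 i) -> upd s x d.*2.+1 i < d.+1.*2.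
    rewrite /upd; case: (i == x); first by rewrite doubleS.
    by move=> /ds /leq_trans; apply; rewrite leq_double.
  by split=> -[a h]; exists a; move: h; rewrite IH // e_.
Qed.

Lemma sat_frename p s v : sat S v (frename s p) <-> sat S (v \o (double \o s)) p.
Proof. by apply: sat_frename_rec => i /=; rewrite odd_double. Qed.

End Renaming.

Local Open Scope classical_set_scope.

(** * Ultrapowers of a structure and the theorem of Łoś *)

Section Ultrapower.
Variables (L : language) (M : Type) (S : structure L M).
Variables (U : set_system nat) (UU : UltraFilter U).

Definition ultra_eq (f g : nat -> M) : Prop := U [set i | f i = g i].

Lemma ultra_eq_refl f : ultra_eq f f.
Proof. by apply: filterS filterT. Qed.

Lemma ultra_eq_class f g : ultra_eq f g -> ultra_eq f = ultra_eq g.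
Proof.
move=> fg; apply: funext => h; apply: propext; split=> H.
- by apply: filterS2 fg H => i /= -> .
- by apply: filterS2 fg H => i /= ->.
Qed.

(** A canonical representative: the choice is made from the predicate [ultra_eq f], which is the
    same for equivalent sequences. This makes the ultrapower a subtype instead of a quotient. *)
Definition ultra_rep (f : nat -> M) : nat -> M :=
  projT1 (cid (ex_intro (ultra_eq f) f (ultra_eq_refl f))).

Lemma ultra_repP f : ultra_eq f (ultra_rep f).
Proof. by rewrite /ultra_rep; case: cid. Qed.

Lemma ultra_rep_eq f g : ultra_eq f g -> ultra_rep f = ultra_rep g.
Proof.
have rep P Q (p : exists h, P h) (q : exists h : nat -> M, Q h) :
    P = Q -> projT1 (cid p) = projT1 (cid q).
  by move=> PQ; move: PQ p q => -> p q; rewrite (Prop_irrelevance p q).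
by move=> /ultra_eq_class; exact: rep.
Qed.

Lemma ultra_rep_idem f : ultra_rep (ultra_rep f) = ultra_rep f.
Proof. by apply/esym/ultra_rep_eq/ultra_repP. Qed.

Definition ultrapower : Type := {f : nat -> M | ultra_rep f = f}.

Definition ultra_class (f : nat -> M) : ultrapower :=
  exist _ (ultra_rep f) (ultra_rep_idem f).

Lemma ultra_classP f g : ultra_class f = ultra_class g <-> ultra_eq f g.
Proof.
split=> [[fg]|fg].
  apply: filterS2 (ultra_repP f) (ultra_repP g) => i /= -> ->.
  by rewrite fg.
by apply: eq_exist; exact: ultra_rep_eq.
Qed.

Lemma ultra_class_sval (a : ultrapower) : ultra_class (sval a) = a.
Proof. by case: a => f hf; apply: eq_exist. Qed.

Definition ultra_structure : structure L ultrapower :=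
  {| funs := fun f args => ultra_class (fun i => funs S f (fun k => sval (args k) i));
     rels := fun r args => U [set i | rels S r (fun k => sval (args k) i)] |}.

Definition slice (F : nat -> nat -> M) (i : nat) : nat -> M := F^~ i.

Lemma slice_args n (T : 'I_n -> nat -> M) :
  U [set i | (fun k => sval (ultra_class (T k)) i) = (fun k => T k i)].
Proof.
have : U [set i | forall k, sval (ultra_class (T k)) i = T k i].
  apply: filter_forall => k; apply: filterS (ultra_repP (T k)) => i /= -> //.
by apply: filterS => i /= H; apply: funext.
Qed.

Lemma eval_ultra F t :
  eval ultra_structure (ultra_class \o F) t =
  ultra_class (fun i => eval S (slice F i) t).
Proof.
elim: t => //= f args IH; apply/ultra_classP.
apply: filterS (slice_args (fun k i => eval S (slice F i) (args k))) => i /= <-.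
by congr funs; apply: funext => k; rewrite IH.
Qed.

(** The theorem of Łoś, by induction on [p]; maximality of [U] enters at negation, choice at the
    quantifier. *)
Lemma sat_ultra p F :
  sat ultra_structure (ultra_class \o F) p <-> U [set i | sat S (slice F i) p].
Proof.
elim: p F => [t u|r ts|q IH|q IHq r IHr|x q IH] F /=.
- by rewrite !eval_ultra; exact: ultra_classP.
- have E := slice_args (fun k i => eval S (slice F i) (ts k)).
  have tsE i : (fun k => sval (eval ultra_structure (ultra_class \o F) (ts k)) i) =
      (fun k => sval (ultra_class (fun i => eval S (slice F i) (ts k))) i).
    by apply: funext => k; rewrite eval_ultra.
  by split=> H; apply: filterS2 E H => i /= <-; rewrite tsE.
- rewrite IH; split=> [nU|UC UA].
    by case: (in_ultra_setVsetC [set i | sat S (slice F i) q] UU).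
  have : U set0 by apply: filterS2 UC UA => i.
  exact: filter_not_empty.
- rewrite IHq IHr; split=> [[A B]|AB]; first by apply: filterS2 A B => i.
  by split; apply: filterS AB => i [].
- have updE g : upd (ultra_class \o F) x (ultra_class g) = ultra_class \o upd F x g.
    by apply: funext => k; rewrite /upd /=; case: (k == x).
  have sliceE g i : slice (upd F x g) i = upd (slice F i) x (g i).
    by apply: funext => k; rewrite /slice /upd; case: (k == x).
  split=> [[a]|].
    rewrite -(ultra_class_sval a) updE IH; apply: filterS => i /=.
    by rewrite sliceE => H; exists (sval a i).
  move=> H.
  (* Witnesses are chosen coordinatewise; [F 0 0] fills the coordinates without one. *)
  have /choice[g gP] : forall i, exists a, (exists e, sat S (upd (slice F i) x e) q) ->
      sat S (upd (slice F i) x a) q.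
    move=> i; case: (pselect (exists e, sat S (upd (slice F i) x e) q)) => [[e eP]|ne].
      by exists e.
    by exists (F 0 0) => /ne.
  exists (ultra_class g); rewrite updE IH; apply: filterS H => i /= /gP.
  by rewrite sliceE.
Qed.

Lemma elem_equiv_ultra : elem_equiv S ultra_structure.
Proof.
move=> p; split=> H v; last first.
  have := H (ultra_class \o (fun k _ => v k)); rewrite sat_ultra => Hv.
  by have [i] := filter_ex Hv.
rewrite (_ : v = ultra_class \o (fun k => sval (v k))); last first.
  by apply: funext => k /=; rewrite ultra_class_sval.
by rewrite sat_ultra; apply: filterS filterT => i _ /=; exact: H.
Qed.

End Ultrapower.

(** * Compactness for dp-patterns *)

Section DpMinimal.
Variables (L : language) (M : Type) (S : structure L M).
Hypothesis dpS : dp_minimal S.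

Definition finite_pattern (phi psi : formula L) (k : nat) (a b : nat -> nat -> M) :=
  forall i0 j0, i0 < k -> j0 < k -> exists e : M,
    [/\ sat S (upd (a i0) 0 e) phi, sat S (upd (b j0) 0 e) psi,
        forall i, i < k -> i <> i0 -> ~ sat S (upd (a i) 0 e) phi &
        forall j, j < k -> j <> j0 -> ~ sat S (upd (b j) 0 e) psi].

(** Over a free ultrafilter, the [i]-th parameters of the [k]-th patterns, as [k] varies, form the
    [i]-th parameter of an infinite pattern in the ultrapower: each of its conditions holds for all
    large [k]. *)
Lemma no_finite_patterns phi psi :
  ~ forall k, exists a b, finite_pattern phi psi k a b.
Proof.
move=> /choice[a /choice[b ab]].
have [U [UU sU]] := ultraFilterLemma eventually_filter.
have large n : U [set i | n < i] by apply: sU; exists n.+1.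
(* The triple is [(i0, j0, k)]; the value is arbitrary when an index is not below [k], which happens
   for small [k] only. *)
have /choice[e eP] : forall t : nat * nat * nat, exists e : M,
    t.1.1 < t.2 -> t.1.2 < t.2 ->
    [/\ sat S (upd (a t.2 t.1.1) 0 e) phi, sat S (upd (b t.2 t.1.2) 0 e) psi,
        forall i, i < t.2 -> i <> t.1.1 -> ~ sat S (upd (a t.2 i) 0 e) phi &
        forall j, j < t.2 -> j <> t.1.2 -> ~ sat S (upd (b t.2 j) 0 e) psi].
  move=> [[i j] k] /=.
  case: (ltnP i k) => ik; last by exists (a 0 0 0).
  case: (ltnP j k) => jk; last by exists (a 0 0 0).
  by have [e eP] := ab k i j ik jk; exists e.
apply: (dpS (elem_equiv_ultra S UU)); exists phi, psi.
pose lift (c : nat -> nat -> nat -> M) (i x : nat) : ultrapower M UU := ultra_class UU (fun k => c k i x).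
exists (lift a), (lift b) => i0 j0 m.
exists (ultra_class UU (fun k => e (i0, j0, k))).
have liftE (c : nat -> nat -> nat -> M) i : upd (lift c i) 0 (ultra_class UU (fun k => e (i0, j0, k))) =
    ultra_class UU \o (fun x k => upd (c k i) 0 (e (i0, j0, k)) x).
  by apply: funext => x; rewrite /upd /=; case: (x == 0).
have sliceE (c : nat -> nat -> nat -> M) i k : slice (fun x k => upd (c k i) 0 (e (i0, j0, k)) x) k =
  upd (c k i) 0 (e (i0, j0, k)) by [].
have good : U [set k | i0 < k /\ j0 < k].
  by apply: filterS2 (large i0) (large j0) => k.
split; [|split; [|split]].
- rewrite liftE sat_ultra; apply: filterS good => k [ik jk]; rewrite /= sliceE.
  by have [] := eP (i0, j0, k) ik jk.
- rewrite liftE sat_ultra; apply: filterS good => k [ik jk]; rewrite /= sliceE.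
  by have [] := eP (i0, j0, k) ik jk.
- move=> i _ ii0; rewrite liftE sat_ultra => bad.
  have [k /= [[[ik jk] iik]]] := filter_ex (filterI (filterI good (large i)) bad).
  by rewrite sliceE; have [_ _ h _] := eP (i0, j0, k) ik jk; exact: h.
- move=> j _ jj0; rewrite liftE sat_ultra => bad.
  have [k /= [[[ik jk] iik]]] := filter_ex (filterI (filterI good (large j)) bad).
  by rewrite sliceE; have [_ _ _ h] := eP (i0, j0, k) ik jk; exact: h.
Qed.

End DpMinimal.

Local Close Scope classical_set_scope.

(** * Closure properties of sets definable with parameters *)

Section Definability.
Variables (L : language) (M : Type) (S : structure L M) (z : M).

Definition valuation V (e : nat -> V + M) (x : V -> M) : nat -> M :=
  fun i => match e i with inl v => x v | inr g => g end.

(* Sets definable with parameters in an arbitrary type [V] of variables; each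
   variable of the formula is read either as a coordinate or as a parameter. *)
Definition Def V (R : (V -> M) -> Prop) : Prop :=
  exists (p : formula L) (e : nat -> V + M),
    forall x, R x <-> sat S (valuation e x) p.

Definition DefFamily V (R : (V -> M) -> M -> Prop) : Prop :=
  Def (fun y : option V -> M => R (fun v => y (Some v)) (y None)).

(** Substituting only variables and constants amounts to rereading the variables of a formula.
    Function symbols enter through their graphs, as in [Def_fun2]. *)
Inductive coord V : ((V -> M) -> M) -> Prop :=
| coord_var v : coord (fun x => x v)
| coord_cst g : coord (fun _ => g).

Lemma coordP V (t : (V -> M) -> M) : coord t ->
  exists s : V + M, t = fun x => match s with inl v => x v | inr g => g end.
Proof. by case=> [v|g]; [exists (inl v)|exists (inr g)]. Qed.

Lemma Def_ext V (R R' : (V -> M) -> Prop) :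
  (forall x, R x <-> R' x) -> Def R -> Def R'.
Proof. by move=> RR' [p [e pe]]; exists p, e => x; rewrite -RR'. Qed.

Lemma Def_app V W (R : (V -> M) -> Prop) (t : V -> (W -> M) -> M) :
  (forall v, coord (t v)) -> Def R -> Def (fun y => R (fun v => t v y)).
Proof.
move=> ct [p [e pe]].
have /choice[s sP] : forall v, exists s : W + M,
    t v = fun x => match s with inl w => x w | inr g => g end.
  by move=> v; exact: coordP.
exists p, (fun i => match e i with inl v => s v | inr g => inr g end) => y.
rewrite pe (_ : valuation e _ = valuation (fun i => match e i with inl v => s v | inr g => inr g end) y) //.
by apply: funext => i; rewrite /valuation; case: (e i) => // v; rewrite sP.
Qed.

Lemma Def_not V (R : (V -> M) -> Prop) : Def R -> Def (fun x => ~ R x).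
Proof. by move=> [p [e pe]]; exists (fneg p), e => x /=; rewrite pe. Qed.

Lemma Def_and V (R R' : (V -> M) -> Prop) :
  Def R -> Def R' -> Def (fun x => R x /\ R' x).
Proof.
move=> [p [e pe]] [p' [e' pe']].
(* As [frename] doubles once more, variable [i] becomes [4 * i] in [p] and [4 * i + 2] in [p']; [e2]
   tells them apart by the parity of [k./2]. *)
exists (fand (frename double p) (frename (succn \o double) p')).
pose e2 k := if odd k./2 then e' k./2./2 else e k./2./2.
exists e2 => x /=; rewrite !sat_frename pe pe'.
suff [-> ->] : valuation e x = valuation e2 x \o (double \o double) /\
  valuation e' x = valuation e2 x \o (double \o (succn \o double)) by [].
by split; apply: funext => i; rewrite /valuation /e2 /= doubleK /= odd_double /= ?uphalf_double ?doubleK.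
Qed.

Lemma Def_or V (R R' : (V -> M) -> Prop) :
  Def R -> Def R' -> Def (fun x => R x \/ R' x).
Proof.
move=> dR dR'; apply: (Def_ext (R := fun x => ~ (~ R x /\ ~ R' x))) => [x|].
  by rewrite not_andP !notK.
by apply: Def_not; apply: Def_and; apply: Def_not.
Qed.

Lemma Def_imp V (R R' : (V -> M) -> Prop) :
  Def R -> Def R' -> Def (fun x => R x -> R' x).
Proof.
move=> dR dR'; apply: (Def_ext (R := fun x => ~ R x \/ R' x)) => [x|].
  by rewrite implyE.
by apply: Def_or => //; apply: Def_not.
Qed.

Lemma Def_iff V (R R' : (V -> M) -> Prop) :
  Def R -> Def R' -> Def (fun x => R x <-> R' x).
Proof. by move=> dR dR'; apply: Def_and; apply: Def_imp. Qed.

Lemma DefFamily_formula V (R : (V -> M) -> M -> Prop) : DefFamily R ->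
  exists (p : formula L) (e : nat -> V + M),
    forall x a, R x a <-> sat S (upd (valuation e x) 0 a) p.
Proof.
move=> [p [e pe]].
(* Variables reading [None] all become 0, the others [i.+1] before the doubling; [e'] decodes them,
   with [inr z] as default. *)
exists (frename (fun i => if e i is inl None then 0 else i.+1) p).
pose e' k := if k./2 is i.+1 then
    match e i with inl (Some v) => inl v | inl None => inr z | inr g => inr g end
  else inr z.
exists e' => x a; rewrite sat_frename.
apply: (iff_trans (pe (oapp x a))).
suff -> : valuation e (oapp x a) = upd (valuation e' x) 0 a
    \o (double \o (fun i => if e i is inl None then 0 else i.+1)) by [].
apply: funext => i; rewrite /valuation /upd /=.
by case ei : (e i) => [[v|]|g] //=; rewrite /e' /= doubleK ei.
Qed.

Lemma Def_ex V (R : (V -> M) -> M -> Prop) :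
  DefFamily R -> Def (fun x => exists a, R x a).
Proof.
move=> /DefFamily_formula[p [e pe]]; exists (fex 0 p), e => x /=.
by split=> -[a]; exists a; apply/pe.
Qed.

Lemma Def_all V (R : (V -> M) -> M -> Prop) :
  DefFamily R -> Def (fun x => forall a, R x a).
Proof.
move=> dR; apply: (Def_ext (R := fun x => ~ exists a, ~ R x a)) => [x|].
  by rewrite -forallNP; split=> H a; [apply: contrapT (H a)|move/(_ (H a))].
by apply: Def_not; apply: (Def_ex (R := fun x a => ~ R x a)); apply: Def_not.
Qed.

Lemma Def_ex_lt V (R : nat -> (V -> M) -> Prop) n :
  (forall i, Def (R i)) -> Def (fun x => exists2 i, i < n & R i x).
Proof.
move=> dR; elim: n => [|n IH].
  exists (fneg (fequal (tvar L 0) (tvar L 0))), (fun=> inr z) => x /=.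
  by split=> // -[].
apply: (Def_ext (R := fun x => (exists2 i, i < n & R i x) \/ R n x)) => [x|].
  split=> [[[i lin Ri]|Rn]|[i]]; first by exists i => //; exact: ltnW.
    by exists n.
  rewrite ltnS leq_eqVlt => /orP[/eqP ->|lin] Ri; first by right.
  by left; exists i.
exact: Def_or.
Qed.

Lemma Def_definable n (X : ('I_n -> M) -> Prop) : definable S X -> Def X.
Proof.
move=> [p [v pv]].
pose e i : 'I_n + M := if (insub i : option 'I_n) is Some j then inl j else inr (v i).
exists p, e => x; rewrite pv; suff -> : env x v = valuation e x by [].
by apply: funext => i; rewrite /env /valuation /e; case: insub.
Qed.

Lemma Def_rel2 (r : rel_sym L) V t u : coord t -> coord u ->
  Def (fun x : V -> M => binR (rels S r) (t x) (u x)).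
Proof.
move=> ct cu.
apply: (Def_app (R := fun y : bool -> M => binR (rels S r) (y true) (y false))
  (t := fun b => if b then t else u)); first by case.
exists (Defs.frel r (fun i => if val i == 0 then tvar L 0 else tvar L 1)).
pose e i : bool + M := inl (i == 0).
exists e => y /=; rewrite /binR.
suff -> : (fun i : 'I_(rarity r) => if val i == 0 then y true else y false) =
  fun i => eval S (valuation e y)
    (if val i == 0 then tvar L 0 else tvar L 1) by [].
by apply: funext => i; case: (val i == 0).
Qed.

Lemma Def_fun2 (f : fun_sym L) V t u w : coord t -> coord u -> coord w ->
  Def (fun x : V -> M => bin (funs S f) (t x) (u x) = w x).
Proof.
move=> ct cu cw.
apply: (Def_app (R := fun y : option bool -> M =>
   bin (funs S f) (y (Some true)) (y (Some false)) = y None)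
  (t := fun b => if b is Some b then if b then t else u else w)).
  by case=> // -[].
exists (fequal (tapp f (fun i => if val i == 0 then tvar L 0 else tvar L 1)) (tvar L 2)).
pose e i : option bool + M :=
  inl (if i == 0 then Some true else if i == 1 then Some false else None).
exists e => y /=; rewrite /bin.
suff -> : (fun i : 'I_(farity f) => if val i == 0 then y (Some true) else y (Some false)) =
  fun i => eval S (valuation e y)
    (if val i == 0 then tvar L 0 else tvar L 1) by [].
by apply: funext => i; case: (val i == 0).
Qed.

Lemma no_family_pattern (V W : Type) (R1 : (V -> M) -> M -> Prop)
    (R2 : (W -> M) -> M -> Prop) :
  dp_minimal S -> DefFamily R1 -> DefFamily R2 ->
  ~ forall k, exists (a : nat -> V -> M) (b : nat -> W -> M),
    forall i0 j0, i0 < k -> j0 < k -> exists e : M,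
    (forall i, i < k -> R1 (a i) e <-> i = i0) /\
    (forall j, j < k -> R2 (b j) e <-> j = j0).
Proof.
move=> dpS /DefFamily_formula[p [e pe]] /DefFamily_formula[q [f qf]] H.
apply: (no_finite_patterns dpS (phi := p) (psi := q)) => k.
have [a [b ab]] := H k.
exists (fun i => valuation e (a i)), (fun j => valuation f (b j)) => i0 j0 ik jk.
have [x [xi xj]] := ab _ _ ik jk; exists x; split.
- by rewrite -pe xi.
- by rewrite -qf xj.
- by move=> i li ne; rewrite -pe xi.
- by move=> j lj ne; rewrite -qf xj.
Qed.

End Definability.

(** * Combinatorics of set families separated by points *)

Section SeparatingPairs.
Variable T : Type.
Implicit Types (D : T -> Prop) (B : nat -> T -> Prop).

Definition agree_at B i j x : Prop := B i x <-> B j x.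

Lemma agree_at_sym B i j x : agree_at B i j x -> agree_at B j i x.
Proof. by rewrite /agree_at => ->. Qed.

Lemma agree_at_third B i j l x : ~ agree_at B i j x -> ~ agree_at B i l x -> agree_at B j l x.
Proof.
rewrite /agree_at; case: (pselect (B i x)); case: (pselect (B j x));
  case: (pselect (B l x)); tauto.
Qed.

Definition separated D B (s : seq nat) :=
  forall i j, i \in s -> j \in s -> i <> j -> exists x, D x /\ ~ agree_at B i j x.

Lemma two_members D B s : uniq s -> separated D B s -> 1 < size s ->
  exists x i j, [/\ i \in s, j \in s, D x & ~ agree_at B i j x].
Proof.
move=> us sep s1.
have i0 : nth 0 s 0 \in s by rewrite mem_nth // ltnW.
have i1 : nth 0 s 1 \in s by rewrite mem_nth.
have [|x [Dx nx]] := sep _ _ i0 i1.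
  by move=> /eqP; rewrite nth_uniq // ltnW.
by exists x, (nth 0 s 0), (nth 0 s 1).
Qed.

(** A point where two members differ splits the list by the value there, so one of the two has a
    large part against it. That member joins the chain and the construction continues inside that
    part; [s'] is what remains at the end. *)
Lemma halving_chain m n : exists N, forall D B s, uniq s -> separated D B s -> N <= size s ->
  exists (b : nat -> nat) (x : nat -> T) (s' : seq nat),
    [/\ uniq s', {subset s' <= s}, n <= size s',
        forall i, i < m -> b i \in s /\ D (x i) &
        forall i, i < m -> (forall j, i < j -> j < m -> ~ agree_at B (b i) (b j) (x i)) /\
           (forall l, l \in s' -> ~ agree_at B (b i) l (x i))].
Proof.
elim: m => [|m [N IH]].
  exists n.+2 => D B s us sep ns.
  have s1 : 1 < size s by apply: leq_trans ns.
  have [t _] := two_members us sep s1.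
  by exists id, (fun=> t), s; split=> //; do 2 apply: ltnW.
exists N.*2.+2 => D B s us sep Ns.
suff [i [j [x [iins Dx dis nij]]]] : exists i j x,
    [/\ i \in s, D x, forall l, l \in j -> ~ agree_at B i l x & N <= size j /\ subseq j s].
  have [|||b [y [s' [us' ss' ns' by_ sepy]]]] := IH D B j.
  - exact: subseq_uniq nij.2 us.
  - by move=> a c /(mem_subseq nij.2) ? /(mem_subseq nij.2); exact: sep.
  - exact: nij.1.
  have jins' := mem_subseq nij.2.
  exists (fun k => if k is k'.+1 then b k' else i), (fun k => if k is k'.+1 then y k' else x), s'.
  split=> //.
  - by move=> l /ss' /jins'.
  - by case=> [_|k km] //; have [/jins'] := by_ k km.
  - case=> [_|k km].
      by split=> [[//|j' _ j'm]|l /ss']; apply: dis => //; have [] := by_ j' j'm.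
    by have [h1 h2] := sepy k km; split=> // -[//|j']; exact: h1.
have s1 : 1 < size s by apply: leq_trans Ns.
have [x [i [j [i0 i1 Dx nx]]]] := two_members us sep s1.
pose t := [seq l <- s | `[< agree_at B i l x >]].
pose t' := [seq l <- s | ~~ `[< agree_at B i l x >]].
have tt : size t + size t' = size s by rewrite !size_filter count_predC.
have [Nt|tN] := leqP N (size t).
  exists j, t, x; split=> //; last by split=> //; exact: filter_subseq.
  move=> l; rewrite mem_filter => /andP[/asboolP il _].
  by move: nx il; rewrite /agree_at; tauto.
exists i, t', x; split=> //; last first.
  split; last exact: filter_subseq.
  rewrite leqNgt; apply/negP => t'N.
  move: Ns; rewrite -tt -addnn leqNgt ltnS; case/negP.
  by apply: ltnW; rewrite -addSn; apply: leq_add => //; exact: ltnW.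
by move=> l; rewrite mem_filter => /andP[/asboolP].
Qed.

(* Pairs are built backwards: the chain preceding the other pairs is long enough
   for two of its members to agree on all the points chosen for those pairs. *)
Lemma separating_pairs m q : exists N, forall D B s (Q : nat -> T), uniq s ->
  separated D B s -> N <= size s ->
  exists (b b' : nat -> nat) (x : nat -> T),
    [/\ forall i, i < m -> [/\ b i \in s, b' i \in s & D (x i)],
        forall i j, i < m -> j < m -> ~ agree_at B (b j) (b' j) (x i) <-> j = i &
        forall j t, j < m -> t < q -> agree_at B (b j) (b' j) (Q t)].
Proof.
elim: m => [|m [N IH]]; first by exists 0 => D B s Q *; exists id, id, Q.
have [N' chain] := halving_chain (2 ^ (q + m)).+1 N.
exists N' => D B s Q us sep Ns.
have [b0 [x0 [s' [us' ss' ns' b0s sep0]]]] := chain D B s us sep Ns.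
have [|b [b' [x [bs sepx agQ]]]] := IH D B s' Q us' _ ns'.
  by move=> i j /ss' ? /ss'; exact: sep.
(* The points on which the new pair must agree: the prescribed [Q], then those of the [m] pairs
   already built. *)
pose P t := if t < q then Q t else x (t - q).
have [i [i' [ii' i'm agP]]] : exists i i', [/\ i < i', i' < (2 ^ (q + m)).+1 &
    forall t, t < q + m -> agree_at B (b0 i) (b0 i') (P t)].
  pose f (i : 'I_(2 ^ (q + m)).+1) := [ffun t : 'I_(q + m) => `[< B (b0 i) (P t) >]].
  have /injectivePn[i [i' ii' fii']] : ~~ injectiveb f.
    apply/injectiveP => /leq_card; rewrite card_ffun card_bool !card_ord.
    by rewrite ltnn.
  have ag t : t < q + m -> agree_at B (b0 i) (b0 i') (P t).
    move=> tm; have := congr1 (fun g : {ffun _ -> _} => g (Ordinal tm)) fii'.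
    rewrite !ffunE /= => E.
    by split=> h; apply/asboolP; [rewrite -E|rewrite E]; apply/asboolP.
  case: (ltngtP i i') => [lt_|lt_|/ord_inj eq_].
  - by exists i, i'; split.
  - by exists i', i; split=> // t tm; apply: agree_at_sym; exact: ag.
  - by rewrite eq_ eqxx in ii'.
have [sep0i sep0s] := sep0 i (ltn_trans ii' i'm).
exists (fun j => if j == m then b0 i else b j), (fun j => if j == m then b0 i' else b' j),
  (fun j => if j == m then x0 i else x j).
split.
- move=> j; rewrite ltnS leq_eqVlt; case: eqP => [_ _|_ /= jm].
    have [bi Dx] := b0s i (ltn_trans ii' i'm); have [bi' _] := b0s i' i'm.
    by split.
  by have [/ss' ? /ss' ? ?] := bs j jm.
- move=> k j; rewrite !ltnS (leq_eqVlt k) (leq_eqVlt j).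
  case: (k =P m) => [->|km]; case: (j =P m) => [->|jm] //= km' jm'.
  + by split=> // _; apply: sep0i.
  (* An old pair lies in [s'], so both its members differ from [b0 i] at [x0 i] and agree with each
     other there. *)
  + split=> // ne; case: ne; have [bj b'j _] := bs j jm'.
    by apply: agree_at_third (sep0s _ bj) (sep0s _ b'j).
  + split=> [ne|mk]; last by case: km.
    case: ne; have := agP (q + k); rewrite /P (ltnNge (q + k) q) leq_addr /= addKn ltn_add2l.
    exact.
  + exact: sepx.
- move=> j t; rewrite ltnS leq_eqVlt; case: eqP => [_ _ tq|_ /= jm tq].
    have := agP t; rewrite /P tq; apply; exact: ltn_addr.
  exact: agQ.
Qed.

End SeparatingPairs.

(** * Order and arithmetic of the group *)

Section DpMinimalDOAG.
Variables (L : language) (M : Type) (S : structure L M).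
Variables (plus : fun_sym L) (less : rel_sym L) (z : M).
Local Notation add := (bin (funs S plus)).
Local Notation lt := (binR (rels S less)).
Local Notation "x +o y" := (add x y) (at level 50, left associativity).
Local Notation "x <o y" := (lt x y) (at level 70, no associativity).
Hypothesis doag : is_DOAG add lt z.
Hypothesis dpS : dp_minimal S.

Lemma lt_irr x : ~ x <o x. Proof. exact: doag_irrefl doag x. Qed.

Lemma lt_tr y x w : x <o y -> y <o w -> x <o w.
Proof. exact: doag_trans doag x y w. Qed.

Lemma lt_asym x y : x <o y -> ~ y <o x.
Proof. by move=> xy /(lt_tr xy) /lt_irr. Qed.

Lemma lt_total x y : x <o y \/ x = y \/ y <o x.
Proof. exact: doag_total doag x y. Qed.

(** [~ w <o y] plays the role of [y <= w], here and below. *)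
Lemma lt_nlt x y w : x <o y -> ~ w <o y -> x <o w.
Proof. by case: (lt_total w y) => [//|[<- //|yw xy _]]; exact: lt_tr yw. Qed.

Lemma addC x y : x +o y = y +o x. Proof. exact: doag_comm doag x y. Qed.
Lemma addA x y w : x +o (y +o w) = x +o y +o w.
Proof. exact: doag_assoc doag x y w. Qed.
Lemma add0 x : z +o x = x. Proof. exact: doag_zero doag x. Qed.
Lemma addr0 x : x +o z = x. Proof. by rewrite addC add0. Qed.
Lemma lt_addr w x y : x <o y -> x +o w <o y +o w.
Proof. exact: doag_compat doag x y w. Qed.
Lemma lt_addl w x y : x <o y -> w +o x <o w +o y.
Proof. by rewrite !(addC w); exact: lt_addr. Qed.

Lemma subP x y : exists d, x +o d = y.
Proof.
by have [x' xx'] := doag_inv doag x; exists (x' +o y); rewrite addA xx' add0.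
Qed.

Lemma lt_addl_iff w x y : (w +o x <o w +o y) <-> x <o y.
Proof.
split; last exact: lt_addl.
have [w' ww'] := doag_inv doag w; move/(lt_addl w').
by rewrite !addA (addC w') ww' !add0.
Qed.

Lemma lt_add_pos x d : (x <o x +o d) <-> z <o d.
Proof. by rewrite -{1}(addr0 x) lt_addl_iff. Qed.

Lemma lt_subP x y : x <o y -> exists d, z <o d /\ x +o d = y.
Proof. by have [d <-] := subP x y => /lt_add_pos ?; exists d. Qed.

Lemma between x y : x <o y -> exists m, x <o m /\ m <o y.
Proof.
move=> /lt_subP[d [d0 <-]].
have [h] := doag_div doag d (isT : 0 < 2); rewrite /= addr0 => hd.
have h0 : z <o h.
  case: (lt_total z h) => [//|[zh|hz]].
    by case: (@lt_irr z); rewrite {2}(_ : z = d) // -hd -zh add0.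
  have hh := lt_addl h hz; rewrite addr0 hd in hh.
  by case: (lt_asym d0); exact: lt_tr hh hz.
by exists (x +o h); split; [exact/lt_add_pos|rewrite -hd addA; exact/lt_add_pos].
Qed.

Lemma lt_min x y y' : x <o y -> x <o y' ->
  exists w, [/\ x <o w, ~ y <o w & ~ y' <o w].
Proof.
move=> xy xy'; case: (lt_total y y') => [yy'|[<-|yy']].
- by exists y; split=> //; [exact: lt_irr|exact: lt_asym].
- by exists y; split=> //; exact: lt_irr.
- by exists y'; split=> //; [exact: lt_asym|exact: lt_irr].
Qed.

Lemma decreasing_between x y : x <o y -> exists c : nat -> M,
  forall i, [/\ x <o c i, c i <o y & c i.+1 <o c i].
Proof.
move=> xy.
have /choice[f fP] : forall w, exists m, x <o w -> x <o m /\ m <o w.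
  by move=> w; case: (pselect (x <o w)) => [/between[m]|]; [exists m|exists w].
have [xf fy] := fP y xy.
have xi i : x <o iter i.+1 f y by elim: i => //= i /fP[].
have dec i : iter i.+2 f y <o iter i.+1 f y by have [] := fP _ (xi i).
exists (fun i => iter i.+1 f y) => i; split => //.
by elim: i => // i; apply: lt_tr.
Qed.

Lemma decreasing_lt (c : nat -> M) i j :
  (forall i, c i.+1 <o c i) -> i < j -> c j <o c i.
Proof.
move=> dec; elim: j => // j IH; rewrite ltnS leq_eqVlt => /orP[/eqP -> //|/IH].
exact: lt_tr.
Qed.

(** * The covering principle on intervals *)

Lemma no_interval_pattern W (Psi : (W -> M) -> M -> Prop) : DefFamily S Psi ->
  ~ forall k, exists (c : nat -> M) (b : nat -> W -> M),
    (forall i, c i.+1 <o c i) /\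
    forall i j, i < k -> j < k -> exists x,
      [/\ c i.+1 <o x, x <o c i & forall j', j' < k -> Psi (b j') x <-> j' = j].
Proof.
move=> dPsi H.
(* Consecutive terms of [c] bound disjoint intervals, which form the first family of the pattern. *)
have dI : DefFamily S (fun (p : bool -> M) x => p true <o x /\ x <o p false).
  by rewrite /DefFamily; apply: Def_and; apply: Def_rel2; constructor.
apply: (no_family_pattern z dpS dI dPsi) => k.
have [c [b [dec cb]]] := H k.
exists (fun i t => if t then c i.+1 else c i), b => i0 j0 ik jk.
have [x [cx xc xj]] := cb i0 j0 ik jk; exists x; split => // i li.
split=> [[cix xci]|-> //]; apply/eqP; rewrite eqn_leq; apply/andP; split.
- rewrite leqNgt; apply/negP => lt0; apply: (@lt_irr x); apply: lt_tr xci _.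
  case: (ltngtP i0.+1 i) lt0 => // [lt1 _|<- _ //].
  by apply: lt_tr cx; exact: decreasing_lt.
- rewrite leqNgt; apply/negP => lt0; apply: (@lt_irr x); apply: lt_tr xc _.
  case: (ltngtP i.+1 i0) lt0 => // [lt1 _|<- _ //].
  by apply: lt_tr cix; exact: decreasing_lt.
Qed.

Definition inI (p q x : M) := p <o x /\ x <o q.

(** Members [b j] alternate with points [x j i], one in each of [k] disjoint intervals: the points
    of rank [j] avoid [b 0], ..., [b j], and [b (j + 1)] contains all the points chosen so far. The
    differences of consecutive members then form a pattern with the intervals. *)
Lemma no_finite_cover_chain W (Psi : (W -> M) -> M -> Prop) (OK : (W -> M) -> Prop) p q :
  DefFamily S Psi -> p <o q ->
  (forall n (x : nat -> M), (forall i, i < n -> inI p q (x i)) ->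
     exists b, OK b /\ forall i, i < n -> Psi b (x i)) ->
  (forall n (b : nat -> W -> M), (forall i, i < n -> OK (b i)) ->
     forall p' q', p' <o q' -> (forall x, inI p' q' x -> inI p q x) ->
     exists x, inI p' q' x /\ forall i, i < n -> ~ Psi (b i) x) ->
  False.
Proof.
move=> dPsi pq h1 h2.
pose Psi2 (y : bool * W -> M) x := Psi (fun w => y (true, w)) x /\ ~ Psi (fun w => y (false, w)) x.
have dPsi2 : DefFamily S Psi2.
  rewrite /DefFamily /Psi2; apply: Def_and; [|apply: Def_not].
  - apply: (Def_app (t := fun (v : option W) (y : option (bool * W) -> M) =>
      if v is Some w then y (Some (true, w)) else y None) _ dPsi).
    by case=> *; constructor.
  - apply: (Def_app (t := fun (v : option W) (y : option (bool * W) -> M) =>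
      if v is Some w then y (Some (false, w)) else y None) _ dPsi).
    by case=> *; constructor.
apply: (no_interval_pattern dPsi2) => k.
have [c cP] := decreasing_between pq.
have cI i x : inI (c i.+1) (c i) x -> inI p q x.
  have [_ ? _] := cP i; have [? _ _] := cP i.+1 => -[? ?].
  by split; [exact: lt_tr (c i.+1) _ _ _ _|exact: lt_tr (c i) _ _ _ _].
have chain m : exists (b : nat -> W -> M) (x : nat -> nat -> M),
    (forall j, j <= m -> OK (b j)) /\
    (forall i j, i < k -> j < m -> inI (c i.+1) (c i) (x j i) /\
       forall j', j' <= m -> Psi (b j') (x j i) <-> j < j').
  elim: m => [|m [b [x [bOK bx]]]].
    have [b [bOK _]] := h1 0 (fun=> p) (fun _ => False_ind _ \o notF).
    by exists (fun=> b), (fun _ _ => p); split.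
  have /choice[y yP] : forall i, exists y, inI (c i.+1) (c i) y /\
      forall j, j <= m -> ~ Psi (b j) y.
    by move=> i; apply: (h2 m.+1 b bOK _ _ _ (cI i)); have [] := cP i.
  pose x' j i := if j == m then y i else x j i.
  have x'I i j : i < k -> j <= m -> inI (c i.+1) (c i) (x' j i).
    move=> ik jm; rewrite /x'; case: eqP => [_|/eqP jne]; first by have [] := yP i.
    by have [] := bx i j ik _; rewrite // ltn_neqAle jne.
  have [bn [bnOK bnQ]] : exists bn, OK bn /\ forall i j, i < k -> j <= m -> Psi bn (x' j i).
    have [|bn [bnOK bnQ]] := h1 (m.+1 * k) (fun t => x' (t %/ k) (t %% k)).
      move=> t tk; have k0 : 0 < k by case: (k) tk; rewrite ?muln0.
      by apply: cI; apply: x'I; rewrite ?ltn_mod // -ltnS ltn_divLR.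
    exists bn; split=> // i j ik jm.
    have := bnQ (j * k + i); rewrite divnMDl ?divn_small ?addn0 ?modnMDl ?modn_small //; last first.
      exact: leq_ltn_trans ik.
    by apply; apply: leq_trans (leq_mul (jm : j.+1 <= m.+1) (leqnn k)); rewrite mulSnr ltn_add2l.
  exists (fun j => if j == m.+1 then bn else b j), x'; split.
    by move=> j; rewrite leq_eqVlt; case: eqP => // _ /bOK.
  move=> i j ik; rewrite ltnS => jm; split; first exact: x'I.
  move=> j'; rewrite leq_eqVlt; case: eqP => [-> _|_ /= jm'].
    by split=> // _; apply: bnQ.
  rewrite /x'; case: eqP => [->|/eqP jne].
    by have [_ yb] := yP i; split=> [/(yb _ jm')//|]; rewrite ltnNge -ltnS jm'.
  have jm1 : j < m by rewrite ltn_neqAle jne.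
  by have [_ h] := bx i j ik jm1; exact: h.
have [b [x [_ bx]]] := chain k.
exists c, (fun j w => b (if w.1 then j.+1 else j) w.2); split => [i|i j ik jk].
  by have [] := cP i.
have [xi xb] := bx i j ik jk.
exists (x j i); case: xi; split=> // j' jk'.
apply: (iff_trans (B := Psi (b j'.+1) (x j i) /\ ~ Psi (b j') (x j i))) => //.
rewrite (xb j' (ltnW jk')) (xb j'.+1 jk') ltnS; split=> [[jj' /negP]|->]; last by rewrite leqnn ltnn.
by rewrite -leqNgt => j'j; apply/eqP; rewrite eqn_leq j'j.
Qed.

Lemma no_max p q x : p <o q -> exists y, x <o y.
Proof. by move=> /lt_subP[d [d0 _]]; exists (x +o d); apply/lt_add_pos. Qed.

(** The minimum of the witnesses works, as each [F i] is inherited by smaller values above [p0]. The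
    base point [p0] will be 0 or the left end of an interval. *)
Lemma common_bound n (F : nat -> M -> Prop) p0 :
  (exists e, p0 <o e) ->
  (forall i e e', F i e -> p0 <o e' -> ~ e <o e' -> F i e') ->
  (forall i, i < n -> exists e, p0 <o e /\ F i e) ->
  exists e, p0 <o e /\ forall i, i < n -> F i e.
Proof.
move=> [e0 pe0] dcl; elim: n => [|n IH] Fn; first by exists e0.
have [|e [pe Fe]] := IH; first by move=> i /ltnW /Fn.
have [e' [pe' Fe']] := Fn n (ltnSn n).
have [w [pw ew e'w]] := lt_min pe pe'.
exists w; split=> // i; rewrite ltnS leq_eqVlt => /orP[/eqP ->|/Fe Fi].
  exact: dcl Fe' pw e'w.
exact: dcl Fi pw ew.
Qed.

(** Statement (2) on the line. The members [{x | F x e}] grow as [e] decreases to [p0], so a finite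
    set lies in one of them and a finite union is contained in one. If none contained a subinterval,
    finite unions would be codense, against the covering principle. *)
Lemma uniform_bound_interval (F : M -> M -> Prop) p0 p q :
  Def S (fun y : bool -> M => F (y true) (y false)) -> p <o q ->
  (forall x e e', F x e -> p0 <o e' -> ~ e <o e' -> F x e') ->
  (forall x, inI p q x -> exists e, p0 <o e /\ F x e) ->
  exists p' q' e, [/\ p' <o q', forall x, inI p' q' x -> inI p q x, p0 <o e &
    forall x, inI p' q' x -> F x e].
Proof.
move=> dF pq dcl Fex; apply: contrapT => nex.
have pmax := no_max p0 pq.
apply: (@no_finite_cover_chain unit (fun b x => F x (b tt)) (fun b => p0 <o b tt) p q) => //.
- apply: (Def_app (t := fun (v : bool) (y : option unit -> M) =>
    if v then y None else y (Some tt)) _ dF).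
  by case; constructor.
- move=> n x xI; have [|e [pe Fe]] := @common_bound n (fun i => F (x i)) p0 pmax (fun i => @dcl (x i)).
    by move=> i /xI /Fex.
  by exists (fun=> e).
- move=> n b bOK p' q' pq' sub.
  have [||e [pe be]] := @common_bound n (fun i e => ~ b i tt <o e) p0 pmax.
  + by move=> i e e' be pe' ee' be'; apply: be; exact: lt_nlt be' ee'.
  + by move=> i /bOK bi; exists (b i tt); split=> //; exact: lt_irr.
  apply: contrapT => nx; apply: nex; exists p', q', e; split=> // x xI.
  apply: contrapT => nF; apply: nx; exists x; split=> // i im Fi.
  by apply: nF; apply: dcl Fi pe (be i im).
Qed.

(** * Right germs of a definable subset of the line *)

Section Germs.
Variable A : M -> Prop.
Hypothesis dA : Def S (fun y : unit -> M => A (y tt)).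
Hypothesis Mpos : exists e, z <o e.

Definition agree_upto a b e := forall h, z <o h -> h <o e -> A (a +o h) <-> A (b +o h).
Definition same_germ a b := exists e, z <o e /\ agree_upto a b e.

(** A sum is not a [coord], hence the quantifier over its value [s]. *)
Lemma Def_shift V t u : coord t -> coord u -> Def S (fun x : V -> M => A (t x +o u x)).
Proof.
move=> ct cu.
apply: (Def_app (R := fun y : bool -> M => A (y true +o y false))
  (t := fun b => if b then t else u)); first by case.
apply: (Def_ext (R := fun y => exists s, y true +o y false = s /\ A s)).
  by move=> y; split=> [[s [-> //]]|As]; exists (y true +o y false).
apply: (Def_ex z); apply: Def_and; first by apply: Def_fun2; constructor.
apply: (Def_app (t := fun _ (y : option bool -> M) => y None) _ dA).
by move=> _; constructor.
Qed.

Lemma Def_agree_upto V t u w : coord t -> coord u -> coord w ->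
  Def S (fun x : V -> M => agree_upto (t x) (u x) (w x)).
Proof.
move=> ct cu cw.
apply: (Def_app (R := fun y : option bool -> M =>
   agree_upto (y (Some true)) (y (Some false)) (y None))
  (t := fun b => if b is Some b then if b then t else u else w)).
  by case=> // -[].
apply: (Def_all z); rewrite /DefFamily.
apply: Def_imp; first by apply: Def_rel2; constructor.
apply: Def_imp; first by apply: Def_rel2; constructor.
by apply: Def_iff; apply: Def_shift; constructor.
Qed.

(** On [Y], each list of truth values of the [P i] either disappears near [z] or recurs arbitrarily
    close to it; [e] is small enough for the disappearing ones to be gone. The induction splits [Y]
    along [P n]. *)
Lemma recurrent_atoms n (P : nat -> M -> Prop) (Y : M -> Prop) :
  exists e, z <o e /\ forall h, z <o h -> h <o e -> Y h -> forall e', z <o e' ->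
    exists h', [/\ z <o h', h' <o e', Y h' & forall i, i < n -> P i h' <-> P i h].
Proof.
elim: n Y => [|n IH] Y.
  case: (pselect (exists e, z <o e /\ forall h, z <o h -> h <o e -> ~ Y h)) => [[e [e0 Ye]]|nY].
    by exists e; split=> // h h0 he /(Ye h h0 he).
  have [e e0] := Mpos; exists e; split=> // h _ _ _ e' e'0.
  apply: contrapT => nh; apply: nY; exists e'; split=> // h' h'0 h'e Yh'.
  by apply: nh; exists h'; split.
have [e1 [e10 e1P]] := IH (fun h => Y h /\ P n h).
have [e2 [e20 e2P]] := IH (fun h => Y h /\ ~ P n h).
have [e [e0 ee1 ee2]] := lt_min e10 e20; exists e; split=> // h h0 he Yh e' e'0.
case: (pselect (P n h)) => Pnh.
  have [h' [h'0 h'e [Yh' Ph'] Pi]] := e1P h h0 (lt_nlt he ee1) (conj Yh Pnh) e' e'0.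
  exists h'; split=> // i; rewrite ltnS leq_eqVlt => /orP[/eqP -> //|]; exact: Pi.
have [h' [h'0 h'e [Yh' Ph'] Pi]] := e2P h h0 (lt_nlt he ee2) (conj Yh Pnh) e' e'0.
by exists h'; split=> // i; rewrite ltnS leq_eqVlt => /orP[/eqP -> //|]; exact: Pi.
Qed.

Lemma finitely_many_germs : exists k (r : nat -> M),
  forall x, exists2 i, i < k & same_germ x (r i).
Proof.
apply: contrapT => nfin.
have indep N : exists r : nat -> M, forall i j, i < j -> j < N -> ~ same_germ (r j) (r i).
  elim: N => [|N [r rP]]; first by exists (fun=> z).
  have [x xP] : exists x, forall i, i < N -> ~ same_germ x (r i).
    apply: contrapT => nx; apply: nfin; exists N, r => x.
    apply: contrapT => ni; apply: nx; exists x => i iN sg; apply: ni; by exists i.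
  exists (fun i => if i == N then x else r i) => i j ij; rewrite ltnS leq_eqVlt.
  case: (j =P N) => [jN _|_ /= jN]; last by rewrite ltn_eqF ?(ltn_trans ij jN) //; exact: rP.
  by rewrite ltn_eqF -?jN //; apply: xP; rewrite -jN.
pose Psi (y : bool -> M) h := ~ (A (y true +o h) <-> A (y false +o h)).
have dPsi : DefFamily S Psi.
  by apply: Def_not; apply: Def_iff; apply: Def_shift; constructor.
apply: (no_interval_pattern dPsi) => k.
(* [N] germs yield [k] separating pairs. Below [e] every combination of truth values recurs, so the
   points [x j] have copies arbitrarily close to [z]. *)
have [N NP] := separating_pairs M k 0; have [r rP] := indep N.
have [e [e0 eP]] := recurrent_atoms N (fun i h => A (r i +o h)) (fun=> True).
pose D h := z <o h /\ h <o e; pose B i h := A (r i +o h).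
have sep : separated D B (iota 0 N).
  move=> i j; rewrite !mem_iota /= => iN jN ij; apply: contrapT => nx.
  have sg i' j' : (forall h, D h -> agree_at B i' j' h) -> same_germ (r i') (r j').
    by move=> H; exists e; split=> // h h0 he; apply: H.
  have ag h : D h -> agree_at B i j h.
    by move=> Dh; apply: contrapT => nag; apply: nx; exists h.
  case: (ltngtP i j) => [lt_|lt_|//].
    by apply: (rP i j lt_ jN); apply: sg => h /ag; exact: agree_at_sym.
  by apply: (rP j i lt_ iN); exact: sg.
have [|b [b' [x [bN bx _]]]] := NP D B (iota 0 N) (fun=> z) (iota_uniq _ _) sep.
  by rewrite size_iota.
(* Between [w'] and [w] lie copies of all the points [x j]; iterating from [e] produces the disjoint
   intervals of the pattern. *)
have step w : exists w', z <o w -> [/\ z <o w', w' <o w & forall j, j < k ->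
    exists h, [/\ w' <o h, h <o w & forall i, i < N -> B i h <-> B i (x j)]].
  case: (pselect (z <o w)) => [w0|]; last by exists w.
  have [||w1 [w10 w1P]] := @common_bound k (fun j w' => exists h, [/\ w' <o h, h <o w &
      forall i, i < N -> B i h <-> B i (x j)]) z Mpos.
  - move=> j u u' [h [uh hw hP]] _ uu'; exists h; split=> //.
    by apply: contrapT => u'h; apply: uu'; exact: lt_nlt uh u'h.
  - move=> j jk; have [_ _ [xj0 xje]] := bN j jk.
    have [h [h0 hw _ hP]] := eP (x j) xj0 xje I w w0.
    by have [w' [w'0 w'h]] := between h0; exists w'; split=> //; exists h.
  (* When [k] is 0 nothing places [w1] below [w]; the minimum with [w2] does. *)
  have [w2 [w20 w2w]] := between w0.
  have [w' [w'0 w1w' w2w']] := lt_min w10 w20; exists w' => _; split=> //.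
    by apply: contrapT => nw; apply: w2w'; exact: lt_nlt w2w nw.
  move=> j /w1P[h [w1h hw hP]]; exists h; split=> //.
  by apply: contrapT => w'h; apply: w1w'; exact: lt_nlt w1h w'h.
have {step}/choice[f fP] := step.
have f0 i : z <o iter i f e by elim: i => //= i /fP[].
exists (fun i => iter i f e), (fun j t => if t then r (b j) else r (b' j)); split.
  by move=> i; have [] := fP _ (f0 i).
move=> i j ik jk; have [_ _ /(_ j jk)[h [h1 h2 hP]]] := fP _ (f0 i).
exists h; split=> // j' j'k.
have [] := bN j' j'k; rewrite !mem_iota /= => bN1 bN2 _.
by rewrite -(bx j j' jk j'k) /Psi /agree_at -(hP _ bN1) -(hP _ bN2).
Qed.

(** * Multiples, and constancy of definable sets on subintervals *)

Local Notation mul := (nmul add z).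

Lemma mulD m n s : mul (m + n) s = mul m s +o mul n s.
Proof. by elim: m => [|m IH]; rewrite ?add0n ?add0 // addSn /= IH addA. Qed.

Lemma mul_lt m n s : z <o s -> m < n -> mul m s <o mul n s.
Proof.
move=> s0; elim: n => // n IH; rewrite ltnS leq_eqVlt /= addC => /orP[/eqP -> |/IH mn].
  exact/lt_add_pos.
by apply: lt_tr mn _; exact/lt_add_pos.
Qed.

(** A quotient that is not positive has no positive multiple. *)
Lemma div_pos n x : 0 < n -> z <o x -> exists y, z <o y /\ mul n y = x.
Proof.
move=> n0 x0; have [y yx] := doag_div doag x n0; exists y; split=> //.
apply: contrapT => y0; have npos m : ~ z <o mul m y.
  elim: m => [|m IH] /=; first exact: lt_irr.
  move=> ypos; have [E|lt0] : mul m y = z \/ mul m y <o z.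
  - by case: (lt_total z (mul m y)) => [/IH //|[E|]]; [left|right].
  - by rewrite E addr0 in ypos.
  - have := lt_addl y lt0; rewrite addr0 => /(lt_tr ypos) //.
by apply: (npos n); rewrite yx.
Qed.

(* Near a point where germs agree uniformly, two of the [k.+1] points
   [u + i * (t / k!)] have the same germ, so [A] is locally invariant under
   translation by a divisor of [t], hence by [t]. *)
Lemma interval_dichotomy p q : p <o q ->
  exists p' q', [/\ p' <o q', forall x, inI p' q' x -> inI p q x &
    (forall x, inI p' q' x -> A x) \/ (forall x, inI p' q' x -> ~ A x)].
Proof.
move=> pq; have [k [r rP]] := finitely_many_germs.
have [|||p' [q' [e [pq' sub e0 eP]]]] :=
  @uniform_bound_interval (fun x e => exists2 i, i < k & agree_upto x (r i) e) z p q _ pq.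
- apply: (Def_ex_lt z) => i; apply: Def_agree_upto; constructor.
- move=> x e e' [i ik ag] _ ee'; exists i => // h h0 he'; apply: ag => //.
  exact: lt_nlt he' ee'.
- by move=> x _; have [i ik [e [e0 ag]]] := rP x; exists e; split=> //; exists i.
(* [n] is half of the minimum of [q' - u] and [e]: points between [u] and [u + 2n] stay in the
   interval and within [e] of [u]. Invariance is proved on the upper half; the lower half is room
   for the points [u + i * s]. *)
have [u [p'u uq']] := between pq'.
have [d [d0 ud]] := lt_subP uq'.
have [w [w0 dw ew]] := lt_min d0 e0.
have [n [n0 nw]] := div_pos (isT : 0 < 2) w0; rewrite /= addr0 in nw.
have un x : x <o u +o n +o n -> x <o q' /\ x <o u +o e.
  move=> xn; split; apply: lt_nlt xn _; rewrite -addA nw -?ud.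
    by move/lt_addl_iff.
  by move/lt_addl_iff.
have per x y : x <o y -> u +o n <o x -> y <o u +o n +o n -> A x <-> A y.
  move=> /lt_subP[t [t0 <-]] unx xtn.
  have tn : t <o n by apply/(lt_addl_iff (u +o n)); apply: lt_tr xtn; exact: lt_addr.
  have [s [s0 sN]] := div_pos (fact_gt0 k) t0.
  have sn i : i <= k -> mul i s <o n.
    move=> ik; have := leq_trans ik (fact_geq k); rewrite leq_eqVlt => /orP[/eqP ->|iN].
      by rewrite sN.
    by apply: lt_tr tn; rewrite -sN; exact: mul_lt.
  have usI i : i <= k -> inI p' q' (u +o mul i s).
    move=> ik; split.
      case: i ik => [_|i ik]; first by rewrite /= addr0.
      by apply: lt_tr p'u _; apply/lt_add_pos; exact: mul_lt (ltn0Sn i).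
    apply: (un _ _).1; apply: lt_tr (_ : u +o n <o _); first exact/lt_addl/sn.
    exact/lt_add_pos.
  have /choice[g gP] : forall i : 'I_k.+1, exists j : 'I_k, agree_upto (u +o mul i s) (r j) e.
    by move=> i; have [j jk ag] := eP _ (usI i (ltn_ord i)); exists (Ordinal jk).
  have [i [i' [ii' i'k ag]]] : exists i i', [/\ i < i', i' <= k &
      agree_upto (u +o mul i s) (u +o mul i' s) e].
    have /injectivePn[i [i' ii' gii']] : ~~ injectiveb g.
      by apply/injectiveP => /leq_card; rewrite !card_ord ltnn.
    have ag a b : g a = g b -> agree_upto (u +o mul a s) (u +o mul b s) e.
      by move=> gab h h0 he; rewrite (gP a h h0 he) gab -(gP b h h0 he).
    case: (ltngtP i i') => [lt_|lt_|/ord_inj eq_].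
    - by exists i, i'; split=> //; [exact: ltn_ord i'|exact: ag].
    - by exists i', i; split=> //; [exact: ltn_ord i|exact: ag].
    - by rewrite eq_ eqxx in ii'.
  (* As [m <= k] divides [k!], the translation by [t] is composed of [k! / m] translations by
     [m * s]. *)
  pose m := i' - i; have m0 : 0 < m by rewrite subn_gt0.
  have mN : m %| k`! by apply: dvdn_fact; rewrite m0 /= (leq_trans (leq_subr _ _)).
  suff H l : l <= k`! %/ m -> A x <-> A (x +o mul (l * m) s).
    by have := H _ (leqnn _); rewrite divnK // sN.
  elim: l => [|l IH] lm; first by rewrite mul0n /= addr0.
  rewrite (IH (ltnW lm)); set v := x +o mul (l * m) s.
  have lN : l * m < k`! by rewrite -(divnK mN) ltn_pmul2r.
  have vt : v <o x +o t by apply: lt_addl; rewrite -sN; exact: mul_lt.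
  (* [v] lies beyond [u + i * s] at a distance [h < e], so the agreement of the two germs compares
     [v] with [v + m * s]. *)
  have uv : u +o mul i s <o v.
    apply: lt_tr (_ : u +o n <o _).
      by apply: lt_addl; apply: sn; exact: leq_trans (ltnW ii') i'k.
    rewrite /v; case: (l * m) => [|j]; first by rewrite /= addr0.
    by apply: lt_tr unx _; apply/lt_add_pos; exact: mul_lt (ltn0Sn j).
  have [h [h0 uh]] := lt_subP uv.
  have he : h <o e.
    have : u +o (mul i s +o h) <o u +o e.
      by rewrite addA uh; apply: (un _ _).2; exact: lt_tr vt xtn.
    move/lt_addl_iff; case: (i : nat) => [|i0]; first by rewrite /= add0.
    by apply: lt_tr; rewrite addC; apply/lt_add_pos; exact: mul_lt (ltn0Sn i0).
  have := ag h h0 he; rewrite uh => ->.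
  rewrite (_ : i' = i + m :> nat); last by rewrite subnKC // ltnW.
  by rewrite mulD addA -(addA _ (mul m s)) (addC (mul m s)) addA uh /v -addA -mulD mulSn addnC.
have [c [nc cn]] : exists c, u +o n <o c /\ c <o u +o n +o n.
  by apply: between; exact/lt_add_pos.
have const x : inI (u +o n) (u +o n +o n) x -> A x <-> A c.
  move=> [nx xn]; case: (lt_total x c) => [xc|[-> //|cx]]; first exact: per.
  by rewrite (per c x).
exists (u +o n), (u +o n +o n); split.
- exact/lt_add_pos.
- move=> x [nx xn]; apply: sub; split; last exact: (un _ xn).1.
  by apply: lt_tr p'u _; apply: lt_tr nx; exact/lt_add_pos.
- case: (pselect (A c)) => Ac; [left|right] => x /const; tauto.
Qed.

End Germs.

(** * Boxes, and the two statements carried through the induction *)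

Definition subbox n (lo' hi' lo hi : 'I_n -> M) :=
  open_box_ok lt lo' hi' /\ forall x, box lt lo' hi' x -> box lt lo hi x.

Definition box_dichotomy n := forall A : ('I_n -> M) -> Prop, Def S A ->
  forall lo hi, open_box_ok lt lo hi -> exists lo' hi', subbox lo' hi' lo hi /\
    ((forall x, box lt lo' hi' x -> A x) \/ (forall x, box lt lo' hi' x -> ~ A x)).

(** Statement (2) over any base point [p0]: the induction also takes for [p0] the left end of an
    interval in the fibres, to make the right end uniform. *)
Definition box_uniform n := forall (F : ('I_n -> M) -> M -> Prop) p0, DefFamily S F ->
  (exists e, p0 <o e) ->
  (forall x e e', F x e -> p0 <o e' -> ~ e <o e' -> F x e') ->
  forall lo hi, open_box_ok lt lo hi ->
  (forall x, box lt lo hi x -> exists e, p0 <o e /\ F x e) ->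
  exists lo' hi' e, [/\ subbox lo' hi' lo hi, p0 <o e &
    forall x, box lt lo' hi' x -> F x e].

Lemma subbox_refl n (lo hi : 'I_n -> M) : open_box_ok lt lo hi -> subbox lo hi lo hi.
Proof. by []. Qed.

Lemma subbox_trans n (lo hi lo1 hi1 lo2 hi2 : 'I_n -> M) :
  subbox lo2 hi2 lo1 hi1 -> subbox lo1 hi1 lo hi -> subbox lo2 hi2 lo hi.
Proof. by move=> [ok2 s2] [_ s1]; split=> // x /s2 /s1. Qed.

Lemma box_point n (lo hi : 'I_n -> M) : open_box_ok lt lo hi -> exists x, box lt lo hi x.
Proof.
move=> ok; have /choice[x xP] : forall i, exists m, lo i <o m /\ m <o hi i.
  by move=> i; exact: between.
by exists x.
Qed.

Lemma DefFamily_fiber V (R : (V -> M) -> M -> Prop) x : DefFamily S R ->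
  Def S (fun y : unit -> M => R x (y tt)).
Proof.
apply: (Def_app (t := fun v (y : unit -> M) => if v is Some v then x v else y tt)).
by case=> [v|]; constructor.
Qed.

Lemma DefFamily_section V (R : (V -> M) -> M -> Prop) c : DefFamily S R ->
  Def S (fun x => R x c).
Proof.
apply: (Def_app (t := fun v (x : V -> M) => if v is Some v then x v else c)).
by case=> [v|]; constructor.
Qed.

(** The covering principle for the complements of the fibres. If no [c] works, the dichotomy shrinks
    the box so that finitely many given points lie outside all the fibres over it. Conversely, a
    dense fibre contains a subinterval of any interval, so finitely many fibres share one and finite
    unions of complements are codense. *)
Lemma common_point n (R : ('I_n -> M) -> M -> Prop) (lo hi : 'I_n -> M) p q :
  box_dichotomy n -> DefFamily S R -> open_box_ok lt lo hi -> p <o q ->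
  (forall x, box lt lo hi x -> forall p' q', p' <o q' ->
     (forall c, inI p' q' c -> inI p q c) -> exists c, inI p' q' c /\ R x c) ->
  exists c lo' hi', [/\ inI p q c, subbox lo' hi' lo hi &
    forall x, box lt lo' hi' x -> R x c].
Proof.
move=> dich dR ok pq dense; apply: contrapT => nc.
have Mpos : exists e, z <o e by exact: no_max pq.
apply: (@no_finite_cover_chain 'I_n (fun x c => ~ R x c) (box lt lo hi) p q) => //.
- exact: Def_not.
- move=> m c cI.
  suff [lo' [hi' [[ok' sub] bad]]] : exists lo' hi', subbox lo' hi' lo hi /\
      forall x, box lt lo' hi' x -> forall i, i < m -> ~ R x (c i).
    have [x xB] := box_point ok'; exists x; split; [exact: sub|exact: bad].
  elim: m cI => [|m IH] cI; first by exists lo, hi; split.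
  have [|lo1 [hi1 [sub1 bad1]]] := IH; first by move=> i /ltnW /cI.
  have [lo2 [hi2 [sub2 [all2|none2]]]] := dich _ (DefFamily_section (c m) dR) _ _ sub1.1.
    case: nc; exists (c m), lo2, hi2; split=> //; first exact: cI.
    exact: subbox_trans sub2 sub1.
  exists lo2, hi2; split; first exact: subbox_trans sub2 sub1.
  move=> x xB i; rewrite ltnS leq_eqVlt => /orP[/eqP ->|]; first exact: none2.
  by apply: bad1; exact: sub2.2.
- move=> m b bOK p' q' pq' sub.
  suff [p1 [q1 [pq1 sub1 R1]]] : exists p1 q1, [/\ p1 <o q1,
      forall c, inI p1 q1 c -> inI p' q' c &
      forall c, inI p1 q1 c -> forall i, i < m -> R (b i) c].
    have [c cI] := between pq1; exists c; split=> [|i im]; first exact: sub1.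
    by move/(_ (R1 c cI i im)).
  elim: m bOK => [|m IH] bOK; first by exists p', q'; split.
  have [|p1 [q1 [pq1 sub1 R1]]] := IH; first by move=> i /ltnW /bOK.
  have [p2 [q2 [pq2 sub2 [all2|none2]]]] :=
    @interval_dichotomy _ (DefFamily_fiber (b m) dR) Mpos _ _ pq1.
    exists p2, q2; split=> //; first by move=> c /sub2 /sub1.
    move=> c cI i; rewrite ltnS leq_eqVlt => /orP[/eqP ->|]; first exact: all2.
    by apply: R1; exact: sub2.
  have [|c [/none2 //]] := dense (b m) (bOK m (ltnSn m)) p2 q2 pq2.
  by move=> c /sub2 /sub1 /sub.
Qed.

(** * Splitting off the last coordinate *)

Definition init n (y : 'I_n.+1 -> M) : 'I_n -> M := fun i => y (widen_ord (leqnSn n) i).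

Definition snoc n (x : 'I_n -> M) (c : M) : 'I_n.+1 -> M :=
  fun i => if unlift ord_max i is Some j then x j else c.

(** Reconciles [init], which uses [widen_ord] like [definable_fun], with [snoc], which uses
    [unlift]. *)
Lemma widen_lift n (i : 'I_n) : widen_ord (leqnSn n) i = lift ord_max i.
Proof. by apply: ord_inj; rewrite lift_max. Qed.

Lemma snoc_init n (y : 'I_n.+1 -> M) : snoc (init y) (y ord_max) = y.
Proof.
apply: funext => i; rewrite /snoc /init; case: unliftP => [j ->|-> //].
by rewrite widen_lift.
Qed.

Lemma init_snoc n (x : 'I_n -> M) c : init (snoc x c) = x.
Proof. by apply: funext => i; rewrite /init /snoc widen_lift liftK. Qed.

Lemma snoc_max n (x : 'I_n -> M) c : snoc x c ord_max = c.
Proof. by rewrite /snoc unlift_none. Qed.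

Lemma ord_maxP n (P : 'I_n.+1 -> Prop) :
  (forall i : 'I_n, P (widen_ord (leqnSn n) i)) -> P ord_max -> forall i, P i.
Proof.
move=> Pw Pm i; case: (unliftP ord_max i) => [j ->|-> //].
by rewrite -widen_lift.
Qed.

Lemma box_snoc n (lo hi : 'I_n -> M) a b y :
  box lt (snoc lo a) (snoc hi b) y <-> box lt lo hi (init y) /\ inI a b (y ord_max).
Proof.
split=> [B|[B I]].
  split; last by have := B ord_max; rewrite !snoc_max.
  by move=> i; have := B (widen_ord (leqnSn n) i);
    rewrite -[snoc lo a _]/(init _ i) -[snoc hi b _]/(init _ i) !init_snoc.
apply: ord_maxP => [i|]; last by rewrite !snoc_max.
by rewrite -[snoc lo a _]/(init _ i) -[snoc hi b _]/(init _ i) !init_snoc; exact: B.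
Qed.

Lemma subbox_snoc n (lo' hi' : 'I_n -> M) (lo hi : 'I_n.+1 -> M) a b :
  subbox lo' hi' (init lo) (init hi) -> a <o b ->
  (forall c, inI a b c -> inI (lo ord_max) (hi ord_max) c) ->
  subbox (snoc lo' a) (snoc hi' b) lo hi.
Proof.
move=> [ok sub] ab I; split.
  apply: ord_maxP => [i|]; last by rewrite !snoc_max.
  by rewrite -[snoc lo' a _]/(init _ i) -[snoc hi' b _]/(init _ i) !init_snoc.
move=> y /box_snoc[/sub B /I yI]; rewrite -(snoc_init lo) -(snoc_init hi).
by apply/box_snoc.
Qed.

Lemma coord_snoc n V (x : 'I_n -> (V -> M) -> M) (c : (V -> M) -> M) :
  (forall i, coord (x i)) -> coord c ->
  forall i, coord (fun y => snoc (fun j => x j y) (c y) i).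
Proof. by move=> cx cc i; rewrite /snoc; case: unlift. Qed.

Lemma Def_snoc n V (A : ('I_n.+1 -> M) -> Prop) (x : 'I_n -> (V -> M) -> M) (c : (V -> M) -> M) :
  Def S A -> (forall i, coord (x i)) -> coord c ->
  Def S (fun y => A (snoc (fun j => x j y) (c y))).
Proof.
move=> dA cx cc; apply: (Def_app (t := fun i y => snoc (fun j => x j y) (c y) i) _ dA).
exact: coord_snoc.
Qed.

Lemma DefFamily_snoc n V (F : ('I_n.+1 -> M) -> M -> Prop) (x : 'I_n -> (V -> M) -> M)
    (c e : (V -> M) -> M) :
  DefFamily S F -> (forall i, coord (x i)) -> coord c -> coord e ->
  Def S (fun y => F (snoc (fun j => x j y) (c y)) (e y)).
Proof.
move=> dF cx cc ce.
apply: (Def_app (t := fun o y => if o is Some i then snoc (fun j => x j y) (c y) i else e y) _ dF).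
by case=> [i|//]; exact: coord_snoc.
Qed.

(** * Induction on the dimension *)

Lemma Def_inI V (t u w : (V -> M) -> M) : coord t -> coord u -> coord w ->
  Def S (fun y => inI (t y) (u y) (w y)).
Proof. by move=> *; apply: Def_and; apply: Def_rel2. Qed.

Lemma inI_shrink a b b' c : ~ b <o b' -> inI a b' c -> inI a b c.
Proof. by move=> bb' [ac cb']; split=> //; exact: lt_nlt cb' bb'. Qed.

(** By [common_point], one [c] starts an interval of constancy of every fibre over some box, and
    [box_uniform] makes its right end [e] uniform. There membership in [A] depends on [x] only, and
    the dichotomy in dimension [n] decides it at height [c1]. *)
Lemma box_dichotomy_step n : box_dichotomy n -> box_uniform n -> box_dichotomy n.+1.
Proof.
move=> dich unif A dA lo hi ok.
have ok0 : open_box_ok lt (init lo) (init hi) by move=> i; exact: ok.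
pose F c x e := (forall c', inI c e c' -> A (snoc x c')) \/
                (forall c', inI c e c' -> ~ A (snoc x c')).
have dF V (x : 'I_n -> (V -> M) -> M) (c e : (V -> M) -> M) :
    (forall i, coord (x i)) -> coord c -> coord e ->
    Def S (fun y => F (c y) (fun i => x i y) (e y)).
  move=> cx cc ce.
  apply: (Def_app (R := fun y : 'I_n + bool -> M => F (y (inr true)) (fun i => y (inl i)) (y (inr false)))
    (t := fun v => match v with inl i => x i | inr b => if b then c else e end)).
    by case=> [i|[]].
  have dA' : Def S (fun y : option ('I_n + bool) -> M => A (snoc (fun i => y (Some (inl i))) (y None))).
    by apply: Def_snoc => [//|i|]; constructor.
  by apply: Def_or; apply: (Def_all z); apply: Def_imp => //;
    first [apply: Def_not => // | apply: Def_inI; constructor].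
pose R x c := exists e, c <o e /\ F c x e.
have dR : DefFamily S R.
  apply: (Def_ex z); apply: Def_and; first by apply: Def_rel2; constructor.
  by apply: (dF _ (fun i y => y (Some (Some i))) (fun y => y (Some None)) (fun y => y None));
    constructor.
have [|c [lo1 [hi1 [[pc cq] sub1 R1]]]] := common_point dich dR ok0 (ok ord_max).
  move=> x _ p' q' pq' sub.
  have dfib : Def S (fun y : unit -> M => A (snoc x (y tt))).
    by apply: (Def_snoc (x := fun i _ => x i) (c := fun y : unit -> M => y tt)) => // *; constructor.
  have [p2 [q2 [pq2 sub2 pure]]] :=
    @interval_dichotomy (fun c => A (snoc x c)) dfib (no_max z pq') _ _ pq'.
  have [c [p2c cq2]] := between pq2; exists c; split; first by apply: sub2.
  exists q2; split=> //; have sub3 c' : inI c q2 c' -> inI p2 q2 c'.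
    by move=> [cc' c'q]; split=> //; exact: lt_tr cc'.
  by case: pure => pure; [left|right] => c' /sub3 /pure.
have [||lo2 [hi2 [e [sub2 ce F2]]]] := unif (fun x e => F c x e) c _ (no_max c pc) _ _ _ sub1.1 R1.
- by apply: (dF _ (fun i y => y (Some i)) (fun _ => c) (fun y => y None)); constructor.
- by move=> x e e' [H|H] ce' ee'; [left|right] => c' /(inI_shrink ee'); exact: H.
have [e1 [ce1 ee1 qe1]] := lt_min ce cq.
have [c1 [cc1 c1e]] := between ce1.
have dA1 : Def S (fun x => A (snoc x c1)).
  by apply: (Def_snoc (x := fun i y => y i) (c := fun=> c1)) => // *; constructor.
have [lo3 [hi3 [sub3 A3]]] := dich _ dA1 _ _ sub2.1.
exists (snoc lo3 c), (snoc hi3 e1); split.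
  apply: subbox_snoc => //.
    exact: subbox_trans sub3 (subbox_trans sub2 sub1).
  by move=> x [cx xe]; split; [exact: lt_tr cx|exact: lt_nlt xe qe1].
have c1I : inI c e c1 by apply: inI_shrink ee1 _.
have F3 y : box lt (snoc lo3 c) (snoc hi3 e1) y -> A y <-> A (snoc (init y) c1).
  move=> /box_snoc[B /(inI_shrink ee1) yI]; rewrite -{1}(snoc_init y).
  case: (F2 (init y) (sub3.2 _ B)) => H.
    by split=> _; exact: H.
  by split=> [/(H _ yI)//|/(H _ c1I)].
case: A3 => A3; [left|right] => y yB; rewrite F3 //; apply: A3;
  by move/box_snoc: yB => [].
Qed.

(** Once [common_point] has fixed the left end [c], uniformity is applied twice: to the bound [e],
    with the interval still depending on [x], then to the right end [d] for that fixed [e]. *)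
Lemma box_uniform_step n : box_dichotomy n -> box_uniform n -> box_uniform n.+1.
Proof.
move=> dich unif F p0 dF pmax dcl lo hi ok Fex.
have ok0 : open_box_ok lt (init lo) (init hi) by move=> i; exact: ok.
pose F3 c x e d := forall c', inI c d c' -> F (snoc x c') e.
have dF3 V (x : 'I_n -> (V -> M) -> M) (c e d : (V -> M) -> M) :
    (forall i, coord (x i)) -> coord c -> coord e -> coord d ->
    Def S (fun y => F3 (c y) (fun i => x i y) (e y) (d y)).
  move=> cx cc ce cd.
  apply: (Def_app (R := fun y : 'I_n + option bool -> M =>
      F3 (y (inr None)) (fun i => y (inl i)) (y (inr (Some true))) (y (inr (Some false))))
    (t := fun v => match v with inl i => x i | inr None => c
                   | inr (Some b) => if b then e else d end)).
    by case=> [i|[[]|]].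
  apply: (Def_all z); apply: Def_imp; first by apply: Def_inI; constructor.
  by apply: (DefFamily_snoc (x := fun i y => y (Some (inl i))) (c := fun y => y None)
    (e := fun y => y (Some (inr (Some true))))) => // *; constructor.
pose R x c := exists d, c <o d /\ exists e, p0 <o e /\ F3 c x e d.
have dR : DefFamily S R.
  apply: (Def_ex z); apply: Def_and; first by apply: Def_rel2; constructor.
  apply: (Def_ex z); apply: Def_and; first by apply: Def_rel2; constructor.
  by apply: (dF3 _ (fun i y => y (Some (Some (Some i)))) (fun y => y (Some (Some None)))
    (fun y => y None) (fun y => y (Some None))); constructor.
have [|c [lo1 [hi1 [[pc cq] sub1 R1]]]] := common_point dich dR ok0 (ok ord_max).
  move=> x xB p' q' pq' sub.
  have dfib : Def S (fun y : bool -> M => F (snoc x (y true)) (y false)).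
    by apply: (DefFamily_snoc (x := fun i _ => x i) (c := fun y : bool -> M => y true)
      (e := fun y => y false)) => // *; constructor.
  have [||p2 [q2 [e [pq2 sub2 e0 eP]]]] := @uniform_bound_interval (fun c e => F (snoc x c) e) p0 _ _ dfib pq'.
  - by move=> c e e'; exact: dcl.
  - move=> c /sub cI; apply: Fex; rewrite -(snoc_init lo) -(snoc_init hi).
    by apply/box_snoc; rewrite init_snoc snoc_max.
  have [c [p2c cq2]] := between pq2; exists c; split; first by apply: sub2.
  exists q2; split=> //; exists e; split=> // c' [cc' c'q].
  by apply: eP; split=> //; exact: lt_tr cc'.
have [|||lo2 [hi2 [e [sub2 pe F2]]]] :=
  unif (fun x e => exists d, c <o d /\ F3 c x e d) p0 _ pmax _ _ _ sub1.1.
- apply: (Def_ex z); apply: Def_and; first by apply: Def_rel2; constructor.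
  by apply: (dF3 _ (fun i y => y (Some (Some i))) (fun=> c)
    (fun y => y (Some None)) (fun y => y None)); constructor.
- move=> x e e' [d [cd H]] pe' ee'; exists d; split=> // c' /H Fe.
  exact: dcl Fe pe' ee'.
- by move=> x /R1[d [cd [e [pe H]]]]; exists e; split=> //; exists d.
have [||lo3 [hi3 [d [sub3 cd F4]]]] :=
  unif (fun x d => F3 c x e d) c _ (no_max c pc) _ _ _ sub2.1 F2.
- by apply: (dF3 _ (fun i y => y (Some i)) (fun=> c) (fun=> e) (fun y => y None)); constructor.
- by move=> x d d' H _ dd' c' /(inI_shrink dd'); exact: H.
have [d1 [cd1 dd1 qd1]] := lt_min cd cq.
exists (snoc lo3 c), (snoc hi3 d1), e; split=> //.
  apply: subbox_snoc => //.
    exact: subbox_trans sub3 (subbox_trans sub2 sub1).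
  by move=> x [cx xe]; split; [exact: lt_tr cx|exact: lt_nlt xe qd1].
move=> y /box_snoc[B /(inI_shrink dd1) yI]; rewrite -(snoc_init y).
exact: F4 yI.
Qed.

Lemma box_dichotomy_uniform n : box_dichotomy n /\ box_uniform n.
Proof.
elim: n => [|n [dich unif]]; last first.
  by split; [exact: box_dichotomy_step|exact: box_uniform_step].
(* The space of dimension 0 has a single point, which starts the induction. *)
have eq0 (x y : 'I_0 -> M) : x = y by apply: funext => -[].
split.
- move=> A _ lo hi ok; exists lo, hi; split; first exact: subbox_refl.
  by case: (pselect (A lo)) => Al; [left|right] => x _; rewrite (eq0 x lo).
- move=> F p0 _ _ _ lo hi ok /(_ lo)[|e [pe Fe]]; first by case.
  exists lo, hi, e; split=> //.
  by move=> x _; rewrite (eq0 x lo).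
Qed.

(** Were no piece to have interior, the dichotomy would shrink the box away from the pieces one
    after the other, leaving points outside all of them. *)
Lemma covered_box n r (P : 'I_r -> ('I_n -> M) -> Prop) lo hi :
  (forall i, Def S (P i)) -> open_box_ok lt lo hi ->
  (forall x, box lt lo hi x -> exists i, P i x) ->
  exists i, nonempty_interior lt (P i).
Proof.
move=> dP ok cover; apply: contrapT => nint.
have [dich _] := box_dichotomy_uniform n.
suff [lo' [hi' [[ok' sub] none]]] : exists lo' hi', subbox lo' hi' lo hi /\
    forall x, box lt lo' hi' x -> forall i, i \in enum 'I_r -> ~ P i x.
  have [x xB] := box_point ok'; have [i Pi] := cover x (sub x xB).
  by apply: (none x xB i) => //; rewrite mem_enum.
elim: (enum 'I_r) => [|i s [lo1 [hi1 [sub1 none1]]]]; first by exists lo, hi.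
have [lo2 [hi2 [sub2 [all2|none2]]]] := dich _ (dP i) _ _ sub1.1.
  by case: nint; exists i, lo2, hi2; split=> //; exact: sub2.1.
exists lo2, hi2; split; first exact: subbox_trans sub2 sub1.
move=> x xB j; rewrite inE => /orP[/eqP ->|]; first exact: none2.
by apply: none1; exact: sub2.2.
Qed.

End DpMinimalDOAG.

(** * Partitions, and functions into the completion *)

Theorem theorem3p4 (L : language) (G : Type) (S : structure L G)
  (plus : fun_sym L) (less : rel_sym L) (z : G) :
  farity plus = 2 -> rarity less = 2 ->
  is_DOAG (bin (funs S plus)) (binR (rels S less)) z ->
  dp_minimal S ->
  let lt := binR (rels S less) in
  forall n : nat, 0 < n ->
  (* (1) *)
  (forall (X : ('I_n -> G) -> Prop) (r : nat) (P : 'I_r -> ('I_n -> G) -> Prop),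
     definable S X -> (forall i, definable S (P i)) ->
     (forall x, X x <-> exists i, P i x) ->
     (forall i j x, P i x -> P j x -> i = j) ->
     nonempty_interior lt X ->
     exists i, nonempty_interior lt (P i)) /\
  (* (2) *)
  (forall f : ('I_n -> G) -> cut lt,
     definable_fun S f -> (forall x, cutL (f x) z) ->
     forall lo hi, open_box_ok lt lo hi ->
     exists lo' hi', open_box_ok lt lo' hi' /\
       (forall x, box lt lo' hi' x -> box lt lo hi x) /\
       exists eps, lt z eps /\ forall x, box lt lo' hi' x -> cutL (f x) eps).
Proof.
move=> _ _ doag dpS lt n n0; split.
- move=> X r P _ dP XP _ [lo [hi [ok BX]]].
  apply: (covered_box doag dpS _ ok) => [i|x /BX /XP //].
  exact: Def_definable.
- move=> f /Def_definable df fz lo hi ok.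
  have [_ unif] := box_dichotomy_uniform doag dpS n.
  (* [cutL (f x) e] reads [e < f x], so (2) is [box_uniform] for this family over [z]. A cut
     containing [z] has no maximum, hence contains some [e] above [z]. *)
  have dF : DefFamily S (fun x e => cutL (f x) e).
    have dsnoc := Def_snoc (x := fun i (y : option 'I_n -> G) => y (Some i)) (c := fun y => y None) df.
    apply: Def_ext (dsnoc _ _) => [y|i|]; try by constructor.
    by rewrite snoc_max -[fun i : 'I_n => _]/(init _) init_snoc.
  have [|||lo' [hi' [eps [[ok' sub] e0 eP]]]] := unif (fun x e => cutL (f x) e) z dF _ _ lo hi ok.
  + apply: (no_max doag z (ok (Ordinal n0))).
  + move=> x e e' fe _ ee'; case: (lt_total doag e e') => [//|[<- //|e'e]].
    exact: cut_down e'e fe.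
  + by move=> x _; have [e] := cut_nomax (fz x); exists e.
  by exists lo', hi'; split=> //; split=> //; exists eps.
Qed.
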